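(* Let $G=(V,E)$ be a graph with irreducible local mechanisms $(\mathcal{M}_x)_{x\in V}$, let $n\ge1$, and consider an ($n$-walker) random walk with local memory on $G$ with initial rotor configuration $\rho$. Then the recurrence probability satisfies $$p_{\mathrm{rec}}(\rho)\in\{0,1\}.$$
   Context: $G=(V,E)$ is a (possibly infinite) simple, connected, locally finite graph; $\mathrm{Ngh}(x)$ is the set of neighbors of $x$. A rotor configuration is a function $\rho:V\to V$ with $\rho(x)\in\mathrm{Ngh}(x)$ for all $x$. Each $x\in V$ is assigned a local mechanism $\mathcal{M}_x$: an irreducible Markov chain with state space $\mathrm{Ngh}(x)$ and transition function $p_x(\cdot,\cdot)$. For $\mathbf{x}=(x^{(1)},\dots,x^{(n)})\in V^n$ and a rotor configuration $\rho$, the ($n$-walker) random walk with local memory (RWLM) with initialization $(\mathbf{x},\rho)$ is the random sequence $(\mathbf{X}_t,\rho_t)_{t\ge0}$, $\mathbf{X}_t=(X_t^{(1)},\dots,X_t^{(n)})$, with $(\mathbf{X}_0,\rho_0)=(\mathbf{x},\rho)$ and the following transitions: given the state at time $t$, let $i\in\{1,\dots,n\}$ with $i\equiv t+1\bmod n$; sample $Y_t$ from $p_{X_t^{(i)}}\big(\rho_t(X_t^{(i)}),\cdot\big)$, independently of the past; set $\rho_{t+1}(X_t^{(i)})=Y_t$ and $\rho_{t+1}(x)=\rho_t(x)$ for $x\ne X_t^{(i)}$; set $X_{t+1}^{(i)}=Y_t$ and $X_{t+1}^{(j)}=X_t^{(j)}$ for $j\neq i$. The walk is recurrent if every vertex of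 $G$ is visited infinitely many times. The recurrence probability $p_{\mathrm{rec}}(\rho)$ is the probability that the RWLM with initialization $(\mathbf{x},\rho)$ is recurrent, where $\mathbf{x}\in V^n$ is arbitrary (the value does not depend on the choice of $\mathbf{x}$, though it may depend on $n$). *)

(* Defs.v *)
From HB Require Import structures.
From mathcomp Require Import all_boot all_order all_algebra.
From mathcomp Require Import all_classical all_reals all_analysis.

Set Implicit Arguments.
Unset Strict Implicit.
Unset Printing Implicit Defensive.

Import Order.TTheory GRing.Theory Num.Theory.

Local Open Scope classical_set_scope.
Local Open Scope ring_scope.

Section Graph.
Variables (V : choiceType) (E : rel V).

Definition Ngh (x : V) : set V := [set y | E x y].

Definition connected_graph : Prop :=
  forall x y : V, exists s : seq V, path E x s /\ last x s = y.

Definition locally_finite : Prop := forall x : V, finite_set (Ngh x).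

Definition walk_graph : Prop :=
  [/\ symmetric E, irreflexive E, connected_graph & locally_finite].

Definition rotor_configuration (rho : V -> V) : Prop :=
  forall x : V, Ngh x (rho x).

End Graph.

(* A family of local mechanisms is [p : V -> V -> V -> R], where [p x y z] is
   the probability that the chain at [x] jumps from [y] to [z].  Only the
   values with [y] and [z] in [Ngh E x] are meaningful, the others are
   arbitrary and never constrained. *)
Section Mechanism.
Variables (R : realType) (V : choiceType) (E : rel V) (p : V -> V -> V -> R).

Definition mechanism_markov (x : V) : Prop :=
  (forall y z, Ngh E x y -> Ngh E x z -> 0 <= p x y z) /\
  (forall y, Ngh E x y -> \sum_(z \in Ngh E x) p x y z = 1).

Fixpoint mechanism_iter (x : V) (k : nat) (y z : V) : R :=
  if k is k'.+1 then
    \sum_(u \in Ngh E x) p x y u * mechanism_iter x k' u z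
  else (y == z)%:R.

Definition mechanism_irreducible (x : V) : Prop :=
  forall y z, Ngh E x y -> Ngh E x z ->
  exists k : nat, 0 < mechanism_iter x k y z.

Definition irreducible_local_mechanisms : Prop :=
  forall x : V, mechanism_markov x /\ mechanism_irreducible x.

End Mechanism.

(* The walkers are numbered from 0, so that the walker moving between the
   times [t] and [t + 1] is the one with number [t %% n]. *)
Definition walker (n : nat) (n_gt0 : (0 < n)%N) (t : nat) : 'I_n :=
  Ordinal (ltn_pmod t n_gt0).

Definition rotor_update (V : choiceType) (rho : V -> V) (a y : V) : V -> V :=
  fun v => if v == a then y else rho v.

Definition position_update (V : choiceType) (n : nat) (X : {ffun 'I_n -> V})
    (i : 'I_n) (y : V) : {ffun 'I_n -> V} :=
  [ffun j => if j == i then y else X j].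

Section RWLM.
Variables (R : realType) (V : choiceType) (E : rel V) (p : V -> V -> V -> R).
Variables (n : nat) (n_gt0 : (0 < n)%N).
Variables (d : measure_display) (Omega : measurableType d).

Definition same_history (X : nat -> Omega -> {ffun 'I_n -> V})
    (rho : nat -> Omega -> V -> V)
    (h : nat -> {ffun 'I_n -> V}) (eta : nat -> V -> V) (t : nat) : set Omega :=
  [set w | forall s, (s <= t)%N -> X s w = h s /\ rho s w = eta s].

(* [(X, rho)] is a random walk with local memory with initialization
   [(x0, rho0)].  The sample [Y_t] is [X t.+1 w (walker n_gt0 t)].  As [V] is
   countable (the graph is connected and locally finite) and the initial state
   is deterministic, the history up to time [t] takes countably many values, so
   the conditional law of [Y_t] given the past is given by the elementary
   conditional probabilities given each possible history [(h, eta)]; measurability of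
   [V]-valued maps is likewise measurability of the fibres.  A history in which
   [eta t a] is not a neighbour of [a] has probability 0. *)
Record is_RWLM (P : probability Omega R) (X : nat -> Omega -> {ffun 'I_n -> V})
    (rho : nat -> Omega -> V -> V) (x0 : {ffun 'I_n -> V}) (rho0 : V -> V)
    : Prop := IsRWLM {
  RWLM_measurable_position : forall t i v,
    measurable [set w | X t w i = v] ;
  RWLM_measurable_rotor : forall t u v,
    measurable [set w | rho t w u = v] ;
  RWLM_init : forall w, X 0%N w = x0 /\ rho 0%N w = rho0 ;
  RWLM_step : forall t w,
    let i := walker n_gt0 t in
    let a := X t w i in
    let y := X t.+1 w i in
    rho t.+1 w = rotor_update (rho t w) a y /\
    X t.+1 w = position_update (X t w) i y ;
  RWLM_sample : forall (t : nat) (h : nat -> {ffun 'I_n -> V})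
      (eta : nat -> V -> V) (y : V),
    let i := walker n_gt0 t in
    let a := h t i in
    Ngh E a y ->
    P (same_history X rho h eta t `&` [set w | X t.+1 w i = y]) =
    (P (same_history X rho h eta t) * (p a (eta t a) y)%:E)%E
}.

Definition recurrent (X : nat -> Omega -> {ffun 'I_n -> V}) : set Omega :=
  [set w | forall v : V, infinite_set [set t | exists i, X t w i = v]].

End RWLM.

(* [r] is the recurrence probability of [rho]: the common value, over all
   starting positions [x] and all realizations of the walk with initialization
   [(x, rho)], of the probability of recurrence. *)
Definition is_recurrence_probability (R : realType) (V : choiceType)
    (E : rel V) (p : V -> V -> V -> R) (n : nat) (n_gt0 : (0 < n)%N)
    (rho : V -> V) (r : R) : Prop :=
  forall (x : {ffun 'I_n -> V}) (d : measure_display)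
         (Omega : measurableType d) (P : probability Omega R)
         (X : nat -> Omega -> {ffun 'I_n -> V}) (rhot : nat -> Omega -> V -> V),
    is_RWLM E p n_gt0 P X rhot x rho -> P (recurrent X) = r%:E.

(* Main.v *)
Require Import Defs.
From mathcomp Require Import all_boot all_order all_algebra.
From mathcomp Require Import all_classical all_reals all_analysis.
From mathcomp Require Import ring lra zify.

Set Implicit Arguments.
Unset Strict Implicit.
Unset Printing Implicit Defensive.

Import Order.TTheory GRing.Theory Num.Theory.
Import numFieldNormedType.Exports.

Local Open Scope classical_set_scope.
Local Open Scope ring_scope.

(** The law of the walk is governed by stacks of rotors, one per vertex, and the
    walk is an abelian network in these stacks: firing two different vertices
    commutes.  Everything below exploits this in expectation, through finite
    averages, so that no space of stacks ever has to be built.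

    A state is a chip count (possibly negative), a rotor configuration and an
    odometer.  For an increasing event [f] of odometers, [winlim f s] is the
    largest probability with which a player who only fires vertices carrying a
    chip can make [f] happen.  The averaged least action principle
    ([win_le_topple]) says that a gift of one extra firing, even an illegal one
    that creates a debt, never hurts.  Hence the order of legal firings is
    irrelevant ([winlim_topple]), and the round robin of the walkers is optimal
    ([robinlim_winlim]): the probability that the walk ever realizes [f] is
    [winlim f], a quantity that only sees the number of walkers at each vertex.

    Let [recval z s] be the limit, as [K] grows, of the value of the event that
    [z] is fired [K] times.  Three facts make it a constant.
    - A vertex fired very often sends many chips to each neighbour, because its
      local chain is finite and irreducible.  So [recval z s] does not depend on
      [z] ([controls_all]), and it is the probability of recurrence
      ([probability_recurrent]).
    - Moving a chip from [z] to [x] does not raise the value at [z]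
      ([winlim_relocate_le]): play as if the chip were still at [z]; when no other
      chip is left near [z], the chip at [x] can at best pay the debt at [z].
      As [z] is arbitrary, [recval] depends only on the number of chips.
    - Firing [v] then shows that [recval], as a function of the rotor at [v], is
      harmonic for the irreducible chain at [v], hence constant
      ([recval_rotor]).

    So [recval] keeps a constant value [c] along the walk.  Let [P] be the
    probability that [z] is fired [K] times, and let [Q] be the probability that
    this happens within [L] moves.  If it has not happened by then, it still does
    with conditional probability at least [c], so that [P >= Q + (1 - Q) c]
    ([winlim_ge_interp]).  As [L] grows, [Q] tends to [P], hence [(1 - P) c <= 0].
    If [c > 0], then [P = 1] for all [K], so [c = 1]. *)

(** * Averages over a rotor step and the firing game *)

Section Game.
Variables (R : realType) (V : choiceType).
Variables (nb : V -> seq V) (q : V -> V -> V -> R).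

Hypothesis q_ge0 : forall v y z, z \in nb v -> 0 <= q v y z.
Hypothesis q_sum1 : forall v y, \sum_(z <- nb v) q v y z = 1.

Definition avg (v y : V) (g : V -> R) : R := \sum_(z <- nb v) q v y z * g z.

Lemma le_avg v y g h :
  (forall z, z \in nb v -> g z <= h z) -> avg v y g <= avg v y h.
Proof.
move=> gh; rewrite /avg big_seq [leRHS]big_seq; apply: ler_sum => z zv.
by apply: ler_wpM2l; [exact: q_ge0|exact: gh].
Qed.

Lemma eq_avg v y g h :
  (forall z, z \in nb v -> g z = h z) -> avg v y g = avg v y h.
Proof.
move=> gh; apply/eqP; rewrite eq_le.
by apply/andP; split; apply: le_avg => z zv; rewrite gh.
Qed.

Lemma avg_affine v y a b g :
  avg v y (fun z => a + b * g z) = a + b * avg v y g.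
Proof.
rewrite /avg -[in RHS](mulr1 a) -(q_sum1 v y) !mulr_sumr -big_split /=.
by apply: eq_bigr => z _; rewrite mulrDr mulrCA [a * _]mulrC.
Qed.

Lemma avg_cst v y a : avg v y (fun=> a) = a.
Proof.
have := avg_affine v y a 0 (fun=> 0).
by under eq_avg do rewrite mul0r addr0; rewrite mul0r addr0.
Qed.

Lemma avgD v y g h : avg v y (fun z => g z + h z) = avg v y g + avg v y h.
Proof.
by rewrite /avg -big_split /=; apply: eq_bigr => z _; rewrite mulrDr.
Qed.

Lemma avgC v y w x (g : V -> V -> R) :
  avg v y (fun z => avg w x (g z)) = avg w x (fun z' => avg v y (g^~ z')).
Proof.
rewrite /avg; under eq_bigr do rewrite mulr_sumr.
rewrite exchange_big /=; apply: eq_bigr => z' _.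
by rewrite mulr_sumr; apply: eq_bigr => z _; rewrite mulrCA.
Qed.

Lemma cvg_avg v y (u : nat -> V -> R) (l : V -> R) :
  (forall z, u n z @[n --> \oo] --> l z) ->
  avg v y (u n) @[n --> \oo] --> avg v y l.
Proof.
move=> ul; apply: cvg_big; first exact: add_continuous.
by move=> z _; apply: cvgMr; exact: ul.
Qed.

(** Counts are integers rather than naturals: comparing two placements of the
    walkers runs through states in which a vertex owes a chip. *)
Record state := State
  { chips : V -> int ; rotors : V -> V ; odo : V -> nat }.

Local Notation start mu rho := (State mu rho (fun=> 0%N)).

Definition fire (v y : V) (s : state) : state :=
  State (fun u => chips s u - (u == v)%:Z + (u == y)%:Z)
        (rotor_update (rotors s) v y)
        (fun u => odo s u + (u == v))%N.

(** The abelian property: a firing reads and writes the rotor of its own vertex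
    only. *)
Lemma fireC v y w x s : v != w -> fire w x (fire v y s) = fire v y (fire w x s).
Proof.
move=> vw; congr State; apply/funext => u /=.
- ring.
- rewrite /rotor_update; case: (eqVneq u v) => // ->.
  by rewrite (negPf vw).
- by rewrite addnAC.
Qed.

Definition topple (v : V) (g : state -> R) (s : state) : R :=
  avg v (rotors s v) (fun y => g (fire v y s)).

Lemma le_topple v g h s :
  (forall y, y \in nb v -> g (fire v y s) <= h (fire v y s)) ->
  topple v g s <= topple v h s.
Proof. exact: le_avg. Qed.

Lemma topple_comm v w g s : v != w ->
  topple v (topple w g) s = topple w (topple v g) s.
Proof.
move=> vw; rewrite /topple /= /rotor_update (eq_sym w) (negPf vw).
rewrite avgC; apply: eq_avg => x _; apply: eq_avg => y _.
by rewrite fireC.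
Qed.

Definition legal (s : state) (v : V) := 0 < chips s v.

Lemma legal_fire s v w y : legal s w -> w != v -> legal (fire v y s) w.
Proof.
rewrite /legal /= => sw /negPf ->.
by case: eqP => _; lia.
Qed.

Definition mono (f : (V -> nat) -> bool) :=
  forall o o', (forall v, o v <= o' v)%N -> f o -> f o'.

Lemma mono_fire f v y s : mono f -> f (odo s) -> f (odo (fire v y s)).
Proof. by move=> mf; apply: mf => u /=; exact: leq_addr. Qed.

(** The value of the game with [L] moves.  Keeping [win f L'] among the options
    allows the player to pass, which matters when no vertex is legal. *)
Fixpoint win (f : (V -> nat) -> bool) (L : nat) (s : state) : R :=
  if L is L'.+1 then
    sup [set r | r = win f L' s \/
                 exists2 v, legal s v & r = topple v (win f L') s]
  else (f (odo s))%:R.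

Lemma win_bounds f L s : 0 <= win f L s <= 1.
Proof.
elim: L s => [|L IH] s /=; first by case: (f _); rewrite ?lexx ?ler01.
set A := [set r | _].
have A1 r : A r -> r <= 1.
  case=> [->|[v sv ->]]; first by case/andP: (IH s).
  rewrite -(avg_cst v (rotors s v) 1); apply: le_avg => y _.
  by case/andP: (IH (fire v y s)).
have AL : A (win f L s) by left.
apply/andP; split; last by apply: ge_sup => //; exists (win f L s).
case/andP: (IH s) => v0 _; apply: le_trans v0 _.
by apply: ub_le_sup => //; exists 1.
Qed.

Lemma win_ge0 f L s : 0 <= win f L s.
Proof. by case/andP: (win_bounds f L s). Qed.

Lemma win_le1 f L s : win f L s <= 1.
Proof. by case/andP: (win_bounds f L s). Qed.

Lemma topple_win_le1 f L v s : topple v (win f L) s <= 1.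
Proof.
by rewrite -(avg_cst v (rotors s v) 1); apply: le_avg => y _; exact: win_le1.
Qed.

Lemma win_succ_ub f L s r :
  (r = win f L s \/ exists2 v, legal s v & r = topple v (win f L) s) ->
  r <= win f L.+1 s.
Proof.
move=> rA /=; apply: ub_le_sup => //; exists 1 => _ [->|[v _ ->]].
  exact: win_le1.
exact: topple_win_le1.
Qed.

Lemma win_leS f L s : win f L s <= win f L.+1 s.
Proof. by apply: win_succ_ub; left. Qed.

Lemma topple_win_leS f L v s : legal s v ->
  topple v (win f L) s <= win f L.+1 s.
Proof. by move=> sv; apply: win_succ_ub; right; exists v. Qed.

Lemma winS_le f L s b : win f L s <= b ->
  (forall v, legal s v -> topple v (win f L) s <= b) -> win f L.+1 s <= b.
Proof.
move=> h1 h2 /=; apply: ge_sup; first by exists (win f L s); left.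
by move=> _ [->//|[v sv ->]]; exact: h2.
Qed.

(** How upper bounds on the value are obtained: no strategy beats a potential
    that dominates the prize and does not increase on average at a legal
    firing. *)
Lemma win_supersolution (f : (V -> nat) -> bool) (g : state -> R) :
  (forall s, (f (odo s))%:R <= g s) ->
  (forall s v, legal s v -> topple v g s <= g s) ->
  forall L s, win f L s <= g s.
Proof.
move=> fg Tg; elim=> [//|L IH] s; apply: winS_le => // v sv.
by apply: le_trans (Tg s v sv); apply: le_topple => y _; exact: IH.
Qed.

(** Least action principle.  Suppose that the optimal first move is [w].  If
    [w = v], the firing of [v] makes this move for free.  Otherwise [w] is still
    legal after [v] is fired, and the two firings commute. *)
Lemma win_le_topple f L v s : mono f -> win f L s <= topple v (win f L) s.
Proof.
move=> mf; elim: L s => [|L IH] s /=.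
  rewrite -(avg_cst v (rotors s v) (f (odo s))%:R); apply: le_avg => y _.
  by rewrite ler_nat; case fs: (f (odo s)) => //; rewrite (mono_fire v y mf fs).
apply: winS_le.
  by apply: le_trans (IH s) _; apply: le_topple => y _; exact: win_leS.
move=> w sw; case: (eqVneq w v) => [->|wv].
  by apply: le_topple => y _; exact: win_leS.
apply: (@le_trans _ _ (topple w (topple v (win f L)) s)).
  by apply: le_topple => y _; exact: IH.
rewrite topple_comm //; apply: le_topple => y _.
by apply: topple_win_leS; exact: legal_fire.
Qed.

(** The value with unlimited time. *)
Definition winlim (f : (V -> nat) -> bool) s : R :=
  sup (range (fun L => win f L s)).

Lemma win_nd f s : nondecreasing_seq (fun L => win f L s).
Proof. by apply/nondecreasing_seqP => L; exact: win_leS. Qed.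

Lemma win_cvg f s : win f L s @[L --> \oo] --> winlim f s.
Proof.
apply: nondecreasing_cvgn; first exact: win_nd.
by exists 1 => _ [L _ <-]; exact: win_le1.
Qed.

Lemma win_le_winlim f L s : win f L s <= winlim f s.
Proof.
by apply: ub_le_sup; [exists 1 => _ [K _ <-]; exact: win_le1|exists L].
Qed.

Lemma winlim_le f s b : (forall L, win f L s <= b) -> winlim f s <= b.
Proof.
by move=> h; apply: ge_sup; [exists (win f 0 s); exists 0%N|move=> _ [L _ <-]].
Qed.

Lemma winlim_ge0 f s : 0 <= winlim f s.
Proof. exact: le_trans (win_ge0 f 0 s) (win_le_winlim f 0 s). Qed.

Lemma winlim_le1 f s : winlim f s <= 1.
Proof. by apply: winlim_le => L; exact: win_le1. Qed.

Lemma winlim_reached (f : (V -> nat) -> bool) s : f (odo s) -> winlim f s = 1.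
Proof.
move=> fs; apply/eqP; rewrite eq_le winlim_le1 /=.
by have := win_le_winlim f 0 s; rewrite /= fs.
Qed.

Lemma le_winlim (f g : (V -> nat) -> bool) s : (forall o, f o -> g o) ->
  winlim f s <= winlim g s.
Proof.
move=> fg; apply: winlim_le => L; apply: le_trans (win_le_winlim g L s).
elim: L s => [|L IH] s /=.
  by rewrite ler_nat; case: (boolP (f (odo s))) => // /fg ->.
apply: winS_le; first exact: le_trans (IH s) (win_leS g L s).
move=> v sv; apply: le_trans (topple_win_leS g L sv).
by apply: le_topple => y _; exact: IH.
Qed.

Lemma topple_winlim_le f v s b : (forall L, topple v (win f L) s <= b) ->
  topple v (winlim f) s <= b.
Proof.
move=> h; have c : topple v (win f L) s @[L --> \oo] --> topple v (winlim f) s.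
  by apply: cvg_avg => y; exact: win_cvg.
apply: (ler_cvg_to c (cvg_cst b)).
by apply: nearW => L; exact: h.
Qed.

Lemma topple_winlim_le_legal f v s : legal s v ->
  topple v (winlim f) s <= winlim f s.
Proof.
move=> sv; apply: topple_winlim_le => L.
exact: le_trans (topple_win_leS f L sv) (win_le_winlim f L.+1 s).
Qed.

Lemma winlim_le_topple f v s : mono f -> winlim f s <= topple v (winlim f) s.
Proof.
move=> mf; apply: winlim_le => L; apply: le_trans (win_le_topple L v s mf) _.
by apply: le_topple => y _; exact: win_le_winlim.
Qed.

(** A legal firing is never a mistake: the value is a martingale along any legal
    play, whatever vertex is chosen. *)
Lemma winlim_topple f v s : mono f -> legal s v ->
  winlim f s = topple v (winlim f) s.
Proof.
by move=> mf sv; apply/eqP;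
  rewrite eq_le winlim_le_topple //= topple_winlim_le_legal.
Qed.

(** * The round robin of labelled walkers is optimal *)

Section RoundRobin.
Variables (n : nat) (n_gt0 : (0 < n)%N).

Definition heap (X : {ffun 'I_n -> V}) (v : V) : int := \sum_i (X i == v)%:Z.

Lemma heap_update X i y v :
  heap (position_update X i y) v = heap X v - (v == X i)%:Z + (v == y)%:Z.
Proof.
rewrite /heap (bigD1 i) //= [in RHS](bigD1 i) //= ffunE eqxx.
under eq_bigr => j ji do rewrite ffunE (negPf ji).
rewrite (eq_sym y) (eq_sym (X i)); ring.
Qed.

Lemma heap_gt0 X i : 0 < heap X (X i).
Proof. by rewrite /heap (bigD1 i) //= eqxx ltr_pwDl // sumr_ge0. Qed.

Lemma heap_legal X v : 0 < heap X v -> exists i, X i = v.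
Proof.
move=> h; apply: contrapT => nex; move: h; rewrite /heap big1 ?ltxx // => i _.
by case: eqP => // Xi; case: nex; exists i.
Qed.

(** The probability that the walkers, playing in turn from time [k], realize [f]
    within [t] steps. *)
Fixpoint robin (f : (V -> nat) -> bool) (t k : nat) (X : {ffun 'I_n -> V})
    (rho : V -> V) (o : V -> nat) : R :=
  if t is t'.+1 then
    let i := walker n_gt0 k in
    avg (X i) (rho (X i)) (fun y =>
      robin f t' k.+1 (position_update X i y) (rotor_update rho (X i) y)
         (fun u => o u + (u == X i))%N)
  else (f o)%:R.

Lemma fire_heap (X : {ffun 'I_n -> V}) i y rho o :
  fire (X i) y (State (heap X) rho o) =
  State (heap (position_update X i y)) (rotor_update rho (X i) y)
        (fun u => o u + (u == X i))%N.
Proof.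
by rewrite /fire /=; congr State; apply/funext => v; rewrite heap_update.
Qed.

Lemma robin_le_win f t k X rho o :
  robin f t k X rho o <= win f t (State (heap X) rho o).
Proof.
elim: t k X rho o => [//|t IH] k X rho o.
have sv : legal (State (heap X) rho o) (X (walker n_gt0 k)) by exact: heap_gt0.
apply: le_trans (topple_win_leS f t sv).
by apply: le_avg => y _; rewrite fire_heap; exact: IH.
Qed.

Lemma robin_leS f t k X rho o : mono f ->
  robin f t k X rho o <= robin f t.+1 k X rho o.
Proof.
move=> mf; elim: t k X rho o => [|t IH] k X rho o; last first.
  by apply: le_avg => y _; exact: IH.
rewrite /= avg_cst ler_nat; case fo: (f o) => //.
by rewrite (mf _ _ _ fo) // => v; exact: leq_addr.
Qed.

Definition robinlim f k X rho o : R :=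
  sup (range (fun t => robin f t k X rho o)).

Lemma robin_le1 f t k X rho o : robin f t k X rho o <= 1.
Proof. exact: le_trans (robin_le_win _ _ _ _ _ _) (win_le1 _ _ _). Qed.

Lemma robin_cvg f k X rho o : mono f ->
  robin f t k X rho o @[t --> \oo] --> robinlim f k X rho o.
Proof.
move=> mf; apply: nondecreasing_cvgn.
  by apply/nondecreasing_seqP => t; exact: robin_leS.
by exists 1 => _ [L _ <-]; exact: robin_le1.
Qed.

Lemma robin_le_robinlim f t k X rho o :
  robin f t k X rho o <= robinlim f k X rho o.
Proof.
by apply: ub_le_sup; [exists 1 => _ [K _ <-]; exact: robin_le1|exists t].
Qed.

Lemma robinlim_step f k i (X : {ffun 'I_n -> V}) rho o : mono f ->
  walker n_gt0 k = i ->
  avg (X i) (rho (X i)) (fun y =>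
    robinlim f k.+1 (position_update X i y) (rotor_update rho (X i) y)
        (fun u => o u + (u == X i))%N) <= robinlim f k X rho o.
Proof.
move=> mf <-; set A := avg _ _ _.
have c : robin f t.+1 k X rho o @[t --> \oo] --> A.
  by apply: cvg_avg => y; exact: robin_cvg.
apply: (ler_cvg_to c (cvg_cst (robinlim f k X rho o))).
by apply: nearW => t; exact: robin_le_robinlim.
Qed.

Lemma walker_turn k (i : 'I_n) : exists j, walker n_gt0 (k + j) = i.
Proof.
(* Waiting for the end of the current round and then [i] more steps. *)
exists (i + (n - k %% n))%N; apply: val_inj => /=.
have kn := ltn_pmod k n_gt0.
have -> : (k + (i + (n - k %% n)) = (k %/ n).+1 * n + i)%N.
  by rewrite {1}(divn_eq k n) mulSn; lia.
by rewrite modnMDl modn_small.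
Qed.

(** The optimal move [w] carries some walker, whose turn comes after finitely
    many steps. Until then other vertices are fired, which by the least action
    principle costs nothing, and [w] can be commuted past them. *)
Lemma win_le_robinlim f L k X rho o : mono f ->
  win f L (State (heap X) rho o) <= robinlim f k X rho o.
Proof.
move=> mf; elim: L k X rho o => [|L IH] k X rho o.
  exact: (robin_le_robinlim f 0 k X rho o).
apply: winS_le; first exact: IH.
move=> w /heap_legal[i Xi].
have [j] := walker_turn k i; elim: j k X rho o Xi => [|j IHj] k X rho o Xi ki.
  rewrite addn0 in ki; rewrite -Xi -ki.
  apply: le_trans (robinlim_step X rho o mf (erefl _)).
  by apply: le_avg => y _; rewrite fire_heap; exact: IH.
set i0 := walker n_gt0 k.
case: (eqVneq (X i0) w) => [<-|i0w].
  apply: le_trans (robinlim_step X rho o mf (erefl _)).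
  by apply: le_avg => y _; rewrite fire_heap; exact: IH.
apply: le_trans (robinlim_step X rho o mf (erefl _)).
apply: (@le_trans _ _
  (topple w (topple (X i0) (win f L)) (State (heap X) rho o))).
  by apply: le_topple => y _; exact: win_le_topple.
rewrite topple_comm 1?eq_sym //; apply: le_avg => y _.
rewrite fire_heap; apply: IHj; last by rewrite addSnnS.
by rewrite ffunE; case: eqP => // ii0; rewrite -Xi ii0 eqxx in i0w.
Qed.

(** In particular the right-hand side forgets which walker stands where and
    whose turn it is. *)
Lemma robinlim_winlim f k X rho o : mono f ->
  robinlim f k X rho o = winlim f (State (heap X) rho o).
Proof.
move=> mf; apply/eqP; rewrite eq_le; apply/andP; split.
  apply: ge_sup; first by exists (robin f 0 k X rho o), 0%N.
  by move=> _ [t _ <-]; exact: le_trans (robin_le_win _ _ _ _ _ _)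
    (win_le_winlim _ _ _).
by apply: winlim_le => L; exact: win_le_robinlim.
Qed.

End RoundRobin.

(** * The local chain at [u] visits every neighbour many times *)

Section LocalChain.
Variables (u v : V).

(** The probability that [K] steps of the chain at [u], started from [y], visit
    [v] fewer than [m] times. *)
Fixpoint few (K m : nat) (y : V) : R :=
  if K is K'.+1 then avg u y (fun z => few K' (m - (z == v))%N z)
  else (0 < m)%N%:R.

Lemma few_ge0 K m y : 0 <= few K m y.
Proof.
elim: K m y => [|K IH] m y /=; first by case: (0 < m)%N.
by rewrite -(avg_cst u y 0); apply: le_avg.
Qed.

Lemma few_le1 K m y : few K m y <= 1.
Proof.
elim: K m y => [|K IH] m y /=; first by case: (0 < m)%N => //=; exact: ler01.
by rewrite -[leRHS](avg_cst u y 1); apply: le_avg.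
Qed.

Lemma few0 K y : few K 0 y = 0.
Proof.
elim: K y => [//|K IH] y /=.
by under eq_avg do rewrite sub0n IH; rewrite avg_cst.
Qed.

Lemma few_mono K m m' y : (m <= m')%N -> few K m y <= few K m' y.
Proof.
elim: K m m' y => [|K IH] m m' y mm' /=; first by rewrite ler_nat; lia.
by apply: le_avg => z _; apply: IH; lia.
Qed.

Lemma few_anti K K' m y : (K <= K')%N -> few K' m y <= few K m y.
Proof.
move=> /subnK <-; elim: (_ - _)%N => [//|j IH]; rewrite addSn.
apply: le_trans IH; elim: (j + K)%N m y => {j K K'} [|K IH] m y /=.
  rewrite -[leRHS](avg_cst u y); apply: le_avg => z _; rewrite ler_nat; lia.
by apply: le_avg => z _; exact: IH.
Qed.

(** Either no visit occurs in the first [K1] steps, or [K2] more steps remain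
    after the first visit. *)
Lemma few_add K1 K2 m e y : (forall z, few K2 m z <= e) ->
  few (K1 + K2) m.+1 y <= few K1 1 y + e.
Proof.
move=> h; have e0 : 0 <= e by apply: le_trans (few_ge0 K2 m y) (h y).
elim: K1 y => [|K IH] y /=.
  by rewrite add0n (le_trans (few_le1 _ _ _)) // ler_wpDr.
rewrite -(avg_cst u y e) -avgD; apply: le_avg => z _.
case: (z == v) => /=; last by rewrite !subn0; exact: IH.
rewrite subn1 subnn few0 add0r; apply: le_trans (h z).
by apply: few_anti; rewrite leq_addl.
Qed.

Lemma few_mul K1 K2 b y : (forall z, few K2 1 z <= b) ->
  few (K1 + K2) 1 y <= few K1 1 y * b.
Proof.
move=> h; elim: K1 y => [|K IH] y /=; first by rewrite add0n mul1r.
rewrite mulrC -[leRHS]add0r -avg_affine; apply: le_avg => z _.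
case: (z == v) => /=; first by rewrite !few0 mulr0 addr0.
by rewrite !subn0 add0r mulrC; exact: IH.
Qed.

Fixpoint chain (k : nat) (y z : V) : R :=
  if k is k'.+1 then avg u y (fun x => chain k' x z) else (y == z)%:R.

Lemma chain_ge0 k y z : 0 <= chain k y z.
Proof.
elim: k y => [|k IH] y /=; first exact: ler0n.
by rewrite -(avg_cst u y 0); apply: le_avg.
Qed.

Lemma chain_le1 k y z : chain k y z <= 1.
Proof.
elim: k y => [|k IH] y /=; first by case: eqP; rewrite ?ler01.
by rewrite -[leRHS](avg_cst u y 1); apply: le_avg.
Qed.

(** If the chain sits at [v] after [k.+1] steps, then it has visited [v]. *)
Lemma few_chain k y : few k.+1 1 y <= 1 - chain k.+1 y v.
Proof.
have h : forall k y, few k (1 - (y == v))%N y <= 1 - chain k y v.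
  elim=> {k y} [|k IH] y /=; first by case: (y == v); rewrite ?subrr ?subr0.
  case: (y == v) => /=.
    rewrite subnn; under eq_avg do rewrite sub0n few0.
    by rewrite avg_cst subr_ge0 (chain_le1 k.+1 y).
  rewrite -[X in 1 - X]mul1r -mulNr -avg_affine subn0; apply: le_avg => z _.
  by rewrite mulN1r; exact: IH.
by rewrite /= -[X in 1 - X]mul1r -mulNr -avg_affine; apply: le_avg => z _;
  rewrite mulN1r; exact: h.
Qed.

Hypothesis vu : v \in nb u.
Hypothesis irr : forall y z, y \in nb u -> z \in nb u ->
  exists k, 0 < chain k y z.

Lemma avg_gt0 y (g : V -> R) : 0 < avg u y g ->
  exists2 z, z \in nb u & 0 < q u y z * g z.
Proof.
move=> h; apply: contrapT => nex; move: h; rewrite ltNge => /negP; apply.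
rewrite /avg big_seq; apply: sumr_le0 => z zu.
by rewrite leNgt; apply/negP => qz; apply: nex; exists z.
Qed.

Lemma few_lt1 y : exists K, few K 1 y < 1.
Proof.
have [z zu] : exists2 z, z \in nb u & 0 < q u y z * 1.
  by apply: avg_gt0; rewrite avg_cst ltr01.
rewrite mulr1 => qz; have [k kz] := irr zu vu.
exists k.+1; apply: le_lt_trans (few_chain k y) _.
rewrite ltrBlDr ltrDl /= /avg (big_rem z) //=.
apply: (@lt_le_trans _ _ (q u y z * chain k z v)); first exact: mulr_gt0.
rewrite lerDl big_seq; apply: sumr_ge0 => x /mem_rem xu.
by apply: mulr_ge0; [exact: q_ge0|exact: chain_ge0].
Qed.

(** From every neighbour [v] is reached with positive probability in finitely
    many steps; there are finitely many neighbours, and one step leads to one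
    of them. *)
Lemma few_uniform : exists K, exists2 b, b < 1 & forall y, few K 1 y <= b.
Proof.
have [K [b b1 h]] : exists K, exists2 b, b < 1 & forall y, y \in nb u ->
  few K 1 y <= b.
  elim: (nb u) => [|x s [K [b b1 h]]]; first by exists 0%N, 0 => //;
    exact: ltr01.
  have [K' hK'] := few_lt1 x.
  exists (maxn K K'), (Num.max b (few K' 1 x)); first by rewrite gt_max b1.
  move=> y; rewrite inE => /orP[/eqP->|ys]; rewrite le_max.
    by rewrite (few_anti _ _ (leq_maxr _ _)) orbT.
  by rewrite (le_trans (few_anti _ _ (leq_maxl _ _)) (h y ys)).
(* One step from an arbitrary rotor leads to a neighbour. *)
exists K.+1, (Num.max b 0); first by rewrite gt_max b1 ltr01.
move=> y /=; rewrite -(avg_cst u y (Num.max b 0)); apply: le_avg => z zu.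
case: eqP => _ /=; first by rewrite few0 le_max lexx orbT.
by rewrite subn0 le_max h.
Qed.

(** Geometric decay for one visit; then the time is cut into [m] pieces, each of
    which misses [v] with small probability. *)
Lemma few_small m e : 0 < e -> exists K, forall y, few K m y <= e.
Proof.
elim: m e => [|m IH] e e0; first by exists 0%N => y; rewrite few0 ltW.
have e20 : 0 < e / 2 by rewrite divr_gt0.
have [K2 h2] := IH _ e20; have [K [b b1 h]] := few_uniform.
have b0 : 0 <= b by apply: le_trans (few_ge0 K 1 u) (h u).
have [j hj] : exists j, b ^+ j <= e / 2.
  have : (b ^+ j @[j --> \oo] --> (0 : R)).
    by apply: cvg_expr; rewrite ger0_norm.
  move=> /cvgrPdist_le/(_ _ e20)[j _ hj]; exists j.
  by have := hj j (leqnn j); rewrite sub0r normrN ger0_norm // exprn_ge0.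
exists (j * K + K2)%N => y; apply: le_trans (few_add _ _ h2) _.
rewrite [leRHS]splitr lerD2r; apply: le_trans hj.
elim: j y => [|j IHj] y; first exact: few_le1.
by rewrite mulSn exprSr addnC; apply: le_trans (few_mul _ _ h) _;
  rewrite ler_wpM2r.
Qed.

End LocalChain.

(** * Frequent firings spread to the whole graph *)

Hypothesis nb_sym : forall x y, y \in nb x -> x \in nb y.
Hypothesis nb_irr : forall x, x \notin nb x.
Hypothesis nb_conn : forall x y, exists s,
  path (fun a b => b \in nb a) x s /\ last x s = y.
Hypothesis q_irr : forall u y z, y \in nb u -> z \in nb u ->
  exists k, 0 < chain u k y z.

Definition posn (c : int) : nat := if c is Posz k then k else 0%N.

Lemma nb_neq u v : v \in nb u -> (u == v) = false.
Proof. by move=> vu; apply/eqP => uv; move: (nb_irr u); rewrite {1}uv vu. Qed.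

(** The chips that reached [v] can be fired there, one after the other, until
    [v] has been fired [m] times. *)
Lemma catch_up (f g : (V -> nat) -> bool) v m s : mono f ->
  (forall o, f o -> ~~ g o -> (o v < m)%N) ->
  f (odo s) -> (m%:Z <= (odo s v)%:Z + chips s v) -> 1 <= winlim g s.
Proof.
move=> mf fg; move jE: (m - odo s v)%N => j.
elim: j s jE => [|j IH] s jE fs ms;
  (have [gs|gs] := boolP (g (odo s)); first by rewrite winlim_reached);
  have sm := fg _ fs gs; first lia.
have sv : legal s v by rewrite /legal; lia.
apply: le_trans (topple_winlim_le_legal g sv).
rewrite -(avg_cst v (rotors s v) 1); apply: le_avg => y yv.
apply: IH; [by rewrite /= eqxx; lia|exact: mono_fire|].
by rewrite /= eqxx (nb_neq yv); lia.
Qed.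

(** The probability that the chain at [u] still sends too few chips to [v].  The
    quantity [m - odo s v - chips s v] is what [v] still has to receive: firing
    [v] leaves it unchanged and each arrival lowers it by one.  A debt at [v]
    counts with its sign, so that arrivals that pay a debt are not lost. *)
Lemma topple_few u v K m w s : v \in nb u -> legal s w ->
  let pot s := few u v (K - odo s u) (posn (m%:Z - (odo s v)%:Z - chips s v))
                 (rotors s u) in
  topple w pot s <= pot s.
Proof.
move=> vu sw /=; rewrite /topple /=.
have uv := nb_neq vu; have vuF : (v == u) = false by rewrite eq_sym.
have posn_mono (a b : int) k : a <= b - k%:Z -> (posn a <= posn b - k)%N.
  by case: a => [a|a]; case: b => [b|b] //=; lia.
case: (eqVneq w u) => [->|wu].
  case KE: (K - odo s u)%N => [|K'].
    rewrite -[leRHS](avg_cst u (rotors s u)); apply: le_avg => y _.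
    rewrite (_ : (K - _)%N = 0%N); last by lia.
    rewrite -[leLHS]/(few u v 0 _ (rotors s u)); apply: few_mono.
    by rewrite -[leqRHS]subn0; apply: posn_mono; rewrite vuF; lia.
  apply: le_avg => y _; rewrite /rotor_update eqxx vuF.
  rewrite (_ : (K - _)%N = K') /=; last by lia.
  by apply: few_mono; apply: posn_mono; rewrite (eq_sym y); lia.
rewrite -[leRHS](avg_cst w (rotors s w)); apply: le_avg => y yw.
rewrite /rotor_update (eq_sym u) (negPf wu) addn0.
apply: few_mono; rewrite -[leqRHS]subn0; apply: posn_mono.
by case: (eqVneq v w) => [->|_]; rewrite ?(nb_neq yw); lia.
Qed.

(** Replacing [f] by [g] costs at most the probability that [u] is fired [K]
    times without sending [m] chips to [v]. *)
Lemma winlim_trade (f g : (V -> nat) -> bool) u v K m s : v \in nb u ->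
  mono f ->
  (forall o, f o -> ~~ g o -> (K <= o u)%N && (o v < m)%N) ->
  winlim f s <= winlim g s +
    few u v (K - odo s u) (posn (m%:Z - (odo s v)%:Z - chips s v)) (rotors s u).
Proof.
move=> vu mf fg; pose pot s :=
  few u v (K - odo s u) (posn (m%:Z - (odo s v)%:Z - chips s v)) (rotors s u).
apply: winlim_le => L.
apply: (win_supersolution (g := fun s => winlim g s + pot s)).
  move=> {L}s; have [fs|_] := boolP (f (odo s)); last first.
    by apply: addr_ge0; [exact: winlim_ge0|exact: few_ge0].
  have [gs|gs] := boolP (g (odo s)).
    by rewrite winlim_reached // lerDl few_ge0.
  have /andP[Ks sm] := fg _ fs gs.
  rewrite /pot (_ : (K - _)%N = 0%N) /=; last by lia.
  case: ltnP => h; first by rewrite lerDr winlim_ge0.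
  have {}h : (m%:Z <= (odo s v)%:Z + chips s v).
    by move: h; case E: (_ - _) => [k|k] /=; lia.
  rewrite addr0; apply: (@catch_up f g v m) => //.
  by move=> o fo go; have /andP[] := fg _ fo go.
move=> {L}s w sw; rewrite /topple avgD; apply: lerD;
  first exact: topple_winlim_le_legal.
exact: topple_few.
Qed.

(** Many firings of [u] entail [m] firings of [v], up to probability [e].  It is
    stated for arbitrary events [f] and [g] that differ only when this fails, so
    that it composes and can be used under intersections and unions. *)
Definition controls u v := forall m e, 0 < e -> exists K,
  forall f g : (V -> nat) -> bool, mono f -> mono g ->
  (forall o, f o -> ~~ g o -> (K <= o u)%N && (o v < m)%N) ->
  forall mu rho, (forall x, 0 <= mu x :> int) -> winlim f (start mu rho) <=
                 winlim g (start mu rho) + e.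

Lemma controls_nb u v : v \in nb u -> controls u v.
Proof.
move=> vu m e e0; have [K hK] := few_small vu (q_irr (u := u)) m e0.
exists K => f g mf mg fg mu rho mu0;
  apply: le_trans (winlim_trade _ vu mf fg) _.
rewrite lerD2l /=; apply: le_trans (hK (rho u)); rewrite subn0.
have posn_le (c : int) : c <= m%:Z -> (posn c <= m)%N by case: c.
by apply: few_mono; apply: posn_le; have := mu0 v; lia.
Qed.

(** The intermediate event requires, inside [f], enough firings of the middle
    vertex. *)
Lemma controls_trans u v w : controls u v -> controls v w -> controls u w.
Proof.
move=> uv vw m e e0; have e20 : 0 < e / 2 by rewrite divr_gt0.
have [K2 h2] := vw m _ e20; have [K1 h1] := uv K2 _ e20.
exists K1 => f g mf mg fg mu rho mu0.
(* Between [f] and [g]: also win when [f] holds and [v] was fired [K2] times. *)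
pose h o := (f o && (K2 <= o v)%N) || g o.
have mh : mono h.
  move=> o o' oo' /orP[/andP[fo Ko]|go]; apply/orP; [left|right].
    by rewrite (mf _ _ oo' fo) (leq_trans Ko).
  exact: mg go.
have fh : winlim f (start mu rho) <= winlim h (start mu rho) + e / 2.
  apply: h1 => // o fo; rewrite /h fo negb_or -ltnNge => /andP[-> go].
  by have /andP[->] := fg _ fo go.
have hg : winlim h (start mu rho) <= winlim g (start mu rho) + e / 2.
  apply: h2 => // o /orP[/andP[fo ->] go|->//].
  by have /andP[_ ->] := fg _ fo go.
by apply: le_trans fh _; rewrite [X in _ <= _ + X]splitr addrA lerD2r.
Qed.

Lemma controls_refl u : controls u u.
Proof.
move=> m e e0; exists m => f g mf mg fg mu rho mu0.
apply: (le_trans (le_winlim (g := g) _ _)); last by rewrite lerDl ltW.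
move=> o fo; apply/negPn/negP => go; have /andP[] := fg _ fo go; lia.
Qed.

Lemma controls_all u v : controls u v.
Proof.
have [s [+ <-]] := nb_conn u v; elim: s u => [|x s IH] u /=.
  by move=> _; exact: controls_refl.
by case/andP=> xu /IH; apply: controls_trans; exact: controls_nb.
Qed.

Definition atleast (z : V) (K : nat) (o : V -> nat) := (K <= o z)%N.

Lemma mono_atleast z K : mono (atleast z K).
Proof. by move=> o o' oo' Ko; exact: leq_trans Ko (oo' z). Qed.

Definition allat (B : seq V) k (o : V -> nat) := all (fun u => k <= o u)%N B.

Lemma mono_allat B k : mono (allat B k).
Proof.
by move=> o o' oo' /allP h; apply/allP => u /h ku; exact: leq_trans ku (oo' u).
Qed.

Lemma mono_and f g : mono f -> mono g -> mono (fun o => f o && g o).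
Proof. by move=> mf mg o o' oo' /andP[/(mf _ _ oo') -> /(mg _ _ oo') ->]. Qed.

Lemma mono_or f g : mono f -> mono g -> mono (fun o => f o || g o).
Proof.
by move=> mf mg o o' oo' /orP[/(mf _ _ oo') ->|/(mg _ _ oo') ->]; rewrite ?orbT.
Qed.

(** One vertex fired often forces a whole finite set to be fired often; the
    vertices of the set are added one at a time. *)
Lemma spread z (B : seq V) k e : 0 < e -> exists K0, forall K, (K0 <= K)%N ->
  forall mu rho, (forall x, 0 <= mu x :> int) ->
    winlim (atleast z K) (start mu rho) <=
    winlim (fun o => atleast z K o && allat B k o) (start mu rho) + e.
Proof.
elim: B e => [|u B IH] e e0.
  exists 0%N => K _ mu rho _;
    apply: (@le_trans _ _ (winlim (fun o => atleast z K o && allat [::] k o)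
    (start mu rho))).
    by apply: le_winlim => o ->.
  by rewrite lerDl ltW.
have e20 : 0 < e / 2 by rewrite divr_gt0.
have [K1 h1] := IH _ e20; have [K2 h2] := controls_all z u k e20.
exists (maxn K1 K2) => K; rewrite geq_max => /andP[K1K K2K] mu rho mu0.
apply: le_trans (h1 K K1K mu rho mu0) _;
  rewrite [X in _ <= _ + X]splitr addrA lerD2r.
apply: h2 => //;
  try by apply: mono_and; [exact: mono_atleast|exact: mono_allat].
move=> o /andP[zo Bo]; rewrite zo /= Bo andbT -ltnNge => ->.
by rewrite (leq_trans K2K).
Qed.

(** Each vertex of [B] controls [z], so its alternative can be dropped at a
    small price; the vertices are dropped one at a time. *)
Lemma gather z (B : seq V) m e : 0 < e -> exists K,
  forall mu rho, (forall x, 0 <= mu x :> int) ->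
    winlim (fun o => atleast z m o || has (fun u => K <= o u)%N B)
      (start mu rho) <=
    winlim (atleast z m) (start mu rho) + e.
Proof.
suff h : 0 < e -> exists K0, forall K, (K0 <= K)%N ->
  forall mu rho, (forall x, 0 <= mu x :> int) ->
    winlim (fun o => atleast z m o || has (fun u => K <= o u)%N B)
      (start mu rho) <=
    winlim (atleast z m) (start mu rho) + e.
  by move=> /h[K0 hK]; exists K0; exact: hK.
have mh K B' : mono (fun o : V -> nat => has (fun u => K <= o u)%N B').
  by move=> o o' oo' /hasP[u uB Ku]; apply/hasP; exists u => //;
    exact: leq_trans Ku _.
elim: B e => [|u B IH] e e0.
  exists 0%N => K _ mu rho _;
    apply: (le_trans (le_winlim (g := atleast z m) _ _)).
    by move=> o; rewrite orbF.
  by rewrite lerDl ltW.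
have e20 : 0 < e / 2 by rewrite divr_gt0.
have [K1 h1] := IH _ e20; have [K2 h2] := controls_all u z m e20.
exists (maxn K1 K2) => K; rewrite geq_max => /andP[K1K K2K] mu rho mu0.
rewrite [X in _ <= _ + X]splitr addrA;
  apply: (le_trans _ (lerD (h1 K K1K mu rho mu0) (lexx _))).
apply: h2 => //; try by apply: mono_or; [exact: mono_atleast|exact: mh].
move=> o /= /or3P[->//|Ku|->]; last by rewrite orbT.
by rewrite negb_or -ltnNge (leq_trans K2K Ku) => /andP[->].
Qed.

(** * Relocating a chip *)

Section Ball.
Variable z : V.

Fixpoint ball (L : nat) : seq V :=
  if L is L'.+1 then ball L' ++ flatten [seq nb u | u <- ball L'] else [:: z].

Lemma ball_center L : z \in ball L.
Proof. by elim: L => [|L IH] /=; rewrite ?inE // mem_cat IH. Qed.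

Lemma ball_nb L w y : y \in nb w -> y \in ball L -> w \in ball L.+1.
Proof.
move=> yw yL; rewrite /= mem_cat; apply/orP; right; apply/flattenP.
by exists (nb y); [exact: map_f|exact: nb_sym].
Qed.

Definition relocate x (s : state) : state :=
  State (fun u => chips s u + (u == x)%:Z - (u == z)%:Z) (rotors s) (odo s).

Lemma fire_relocate v y x s : fire v y (relocate x s) = relocate x (fire v y s).
Proof. by congr State; apply/funext => u /=; ring. Qed.

(** Without chips of [s] in the ball, only the chip added at [x] can arrive at
    [z] in time, and it merely pays for the chip removed from [z]; so [z] is
    never legal. *)
Lemma win_unreachable K L x s :
  (forall u, u \in ball L -> chips s u <= 0) -> (odo s z < K)%N ->
  win (atleast z K) L (relocate x s) <= 0.
Proof.
elim: L x s => [|L IH] x s far sK.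
  by rewrite /= /atleast leqNgt sK.
have far' u : u \in ball L -> chips s u <= 0.
  by move=> uL; apply: far; rewrite /= mem_cat uL.
apply: winS_le; first exact: IH.
move=> w; rewrite /legal /= => sw.
have wz : (w == z) = false.
  by apply/eqP => wz; move: sw (far z (ball_center _)); rewrite wz eqxx; lia.
have zw : (z == w) = false by rewrite eq_sym.
rewrite -(avg_cst w (rotors (relocate x s) w) 0); apply: le_avg => y yw.
have [ws|ws] := ltP 0 (chips s w).
  rewrite fire_relocate; apply: IH; last by rewrite /= zw addn0.
  move=> u uL /=; have /negPf -> : u != y.
    apply/eqP => uy; have := far w (ball_nb yw _); rewrite -uy uL => /(_ isT);
      lia.
  by have := far' u uL; lia.
have wx : w = x by apply/eqP; move: sw; rewrite wz; lia.
have -> : fire w y (relocate x s) =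
  relocate y (State (chips s) (rotor_update (rotors s) w y)
                    (fun u => odo s u + (u == w))%N).
  by congr State; apply/funext => u /=; rewrite wx; ring.
by apply: IH => //=; rewrite zw addn0.
Qed.

(** As long as [s] has a chip in the ball, fire it in both states: it is legal
    in [s], and in the relocated state the least action principle allows it
    even if it is a debt. Each such firing counts in the sum over the ball, so
    after [N] of them the right-hand event is reached; if the chips run out
    before that, the left-hand side vanishes. *)
Lemma win_relocate_le K L M N x s :
  (M <= \sum_(u <- undup (ball L)) odo s u + N)%N ->
  win (atleast z K) L (relocate x s) <=
  winlim (fun o => atleast z K o || (M <= \sum_(u <- undup (ball L)) o u)%N) s.
Proof.
set g := fun o : V -> nat => _ || _.
have mg : mono g.
  apply: mono_or; first exact: mono_atleast.
  by move=> o o' oo' /leq_trans; apply; apply: leq_sum.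
elim: N s => [|N IH] s sN.
  by rewrite winlim_reached ?win_le1 // /g -(addn0 (\sum_(_ <- _) _)%N) sN orbT.
have [sK|sK] := ltnP (odo s z) K; last first.
  by rewrite winlim_reached ?win_le1 // /g /atleast sK.
have [[v vB sv]|nv] := pselect (exists2 v, v \in ball L & legal s v).
  apply: le_trans (win_le_topple L v _ (mono_atleast (K := K))) _.
  apply: le_trans (topple_winlim_le_legal g sv); apply: le_avg => y _.
  rewrite fire_relocate; apply: IH => /=.
  rewrite big_split /= -addnA (leq_trans sN) // leq_add2l.
  by rewrite [X in (_ <= X + _)%N](bigD1_seq v)
    ?undup_uniq ?mem_undup //= eqxx; lia.
apply: le_trans (winlim_ge0 _ _); apply: win_unreachable => // u uB.
by rewrite leNgt; apply/negP => us; apply: nv; exists u.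
Qed.

(** Many firings in a ball force [K] firings of [z] with high probability, so
    the second alternative in [win_relocate_le] is negligible. *)
Lemma winlim_relocate_le K x mu rho : (forall u, 0 <= mu u) ->
  winlim (atleast z K) (relocate x (start mu rho)) <=
  winlim (atleast z K) (start mu rho).
Proof.
move=> mu0; apply: winlim_le => L; apply/ler_addgt0Pr => e e0.
have [K' hK'] := gather z (undup (ball L)) K e0.
apply: le_trans (hK' _ rho mu0).
(* Pigeonhole: [M] firings in the ball give some vertex at least [K'] of
   them. *)
pose M := (size (undup (ball L)) * K').+1.
apply: le_trans (@win_relocate_le K L M M x _ (leq_addl _ _)) _.
apply: le_winlim => o /orP[->//|Mo]; apply/orP; right.
apply: contraLR Mo => /hasPn h; rewrite -ltnNge ltnS.
have -> : (size (undup (ball L)) * K' = \sum_(u <- undup (ball L)) K')%N.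
  by rewrite big_const_seq count_predT iter_addn_0 mulnC.
rewrite big_seq [leqRHS]big_seq; apply: leq_sum => u uB.
by apply: ltnW; rewrite ltnNge h.
Qed.

End Ball.

(** * The recurrence value *)

Definition recval (z : V) (s : state) : R :=
  inf (range (fun K => winlim (atleast z K) s)).

Lemma recval_le_winlim z s K : recval z s <= winlim (atleast z K) s.
Proof.
by apply: ge_inf; [exists 0 => _ [k _ <-]; exact: winlim_ge0|exists K].
Qed.

Lemma le_recval z s b : (forall K, b <= winlim (atleast z K) s) ->
  b <= recval z s.
Proof.
move=> h; apply: lb_le_inf; first by exists (winlim (atleast z 0) s), 0%N.
by move=> _ [K _ <-].
Qed.

Lemma recval_cvg z s : winlim (atleast z K) s @[K --> \oo] --> recval z s.
Proof.
apply: nonincreasing_cvgn; last by exists 0 => _ [k _ <-]; exact: winlim_ge0.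
by move=> K K' KK'; apply: le_winlim => o; exact: leq_trans.
Qed.

(** What was fired in the past only shifts the target. *)
Lemma win_shift f L mu rho o o' :
  win f L (State mu rho (fun u => o u + o' u)%N) =
  win (fun a => f (fun u => a u + o' u)%N) L (State mu rho o).
Proof.
elim: L mu rho o => [//|L IH] mu rho o /=; congr sup.
have h v : topple v (win f L) (State mu rho (fun u => o u + o' u)%N) =
    topple v (win (fun a => f (fun u => a u + o' u)%N) L) (State mu rho o).
  apply: eq_avg => y _; rewrite /fire /= -IH; congr (win f L (State _ _ _)).
  by apply/funext => u; rewrite addnAC.
apply/seteqP; split=> r [->|[v sv ->]]; [left|right|left|right] => //.
- by exists v => //; rewrite h.
- by exists v => //; rewrite -h.
Qed.

(** Past firings are irrelevant for an event at infinity. *)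
Lemma recval_odo z s : recval z s =
  recval z (State (chips s) (rotors s) (fun=> 0%N)).
Proof.
case: s => mu rho o /=.
have h K : winlim (atleast z (K + o z)) (State mu rho o) =
           winlim (atleast z K) (start mu rho).
  rewrite /winlim; suff -> : win (atleast z (K + o z)) ^~ (State mu rho o) =
      win (atleast z K) ^~ (start mu rho) by [].
  apply/funext => L.
  apply: etrans; first exact: (win_shift _ L mu rho (fun=> 0%N) o).
  by congr (win _ _ _); apply/funext => a; rewrite /atleast leq_add2r.
have := @recval_cvg z (State mu rho o); rewrite -(cvg_shiftn (o z)) /=.
under eq_fun do rewrite h.
by move=> c; apply: (cvg_unique _ c (@recval_cvg z _)).
Qed.

Lemma recval_topple z v s : legal s v -> recval z s = topple v (recval z) s.
Proof.
move=> sv; have c :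
    topple v (winlim (atleast z K)) s @[K --> \oo] --> topple v (recval z) s.
  by apply: cvg_avg => y; exact: recval_cvg.
apply: (cvg_unique _ (@recval_cvg z s)) => //=.
by under eq_fun do rewrite (winlim_topple (mono_atleast (z := _) (K := _)) sv).
Qed.

Definition nonneg (s : state) := forall u, 0 <= chips s u.

Lemma recval_indep_le u v s : nonneg s -> recval u s <= recval v s.
Proof.
move=> s0; rewrite recval_odo [leRHS]recval_odo; apply: le_recval => m;
  apply/ler_addgt0Pr => e e0.
have [K hK] := controls_all u v m e0.
apply: le_trans (recval_le_winlim _ _ K) _; apply: hK => //;
  try exact: mono_atleast.
by move=> o; rewrite /atleast -ltnNge => -> ->.
Qed.

Lemma recval_indep u v s : nonneg s -> recval u s = recval v s.
Proof. by move=> s0; apply/eqP; rewrite eq_le !recval_indep_le. Qed.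

(** The vertex at which firings are counted may be taken to be the one that
    loses the chip, which is where [winlim_relocate_le] applies. *)
Lemma recval_relocate_le z v y s : nonneg s -> legal s v ->
  recval z (relocate v y s) <= recval z s.
Proof.
move=> s0 sv; rewrite (recval_indep z v) ?(recval_indep z v s0) //; last first.
  by move=> u /=; case: (eqVneq u v) => [->|uv]; move: sv (s0 u);
    rewrite /legal; lia.
rewrite recval_odo [leRHS]recval_odo; apply: le_recval => K;
  apply: le_trans (recval_le_winlim _ _ K) _.
exact: winlim_relocate_le.
Qed.

Lemma recval_relocate z v y s : nonneg s -> legal s v ->
  recval z (relocate v y s) = recval z s.
Proof.
move=> s0 sv; apply/eqP; rewrite eq_le recval_relocate_le //=.
set s' := relocate v y s.
have s'0 : nonneg s'.
  by move=> u /=; case: (eqVneq u v) => [->|uv]; move: sv (s0 u);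
    rewrite /legal; lia.
have -> : s = relocate y v s'.
  rewrite /s' /relocate /=; case: (s) => mu rho o /=; congr State.
  by apply/funext => u; ring.
apply: recval_relocate_le => //; rewrite /legal /=.
by case: (eqVneq y v) => [->|yv]; rewrite eqxx; move: sv (s0 y);
  rewrite /legal; lia.
Qed.

Lemma seq_max (g : V -> R) (r : seq V) x0 : x0 \in r ->
  exists2 x, x \in r & forall y, y \in r -> g y <= g x.
Proof.
elim: r x0 => [//|a [|b r] IH] x0 _.
  by exists a; rewrite ?mem_head // => y; rewrite inE => /eqP->.
have [x xr hx] := IH b (mem_head _ _).
have [ax|xa] := leP (g a) (g x).
  exists x; first by rewrite inE xr orbT.
  by move=> y; rewrite inE => /orP[/eqP->//|]; exact: hx.
exists a; first exact: mem_head.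
move=> y; rewrite inE => /orP[/eqP->//|/hx yx]; exact: le_trans yx (ltW xa).
Qed.

(** Maximum principle: the maximum over the neighbours propagates along the
    steps of positive probability, which lead from any neighbour to any other.
    *)
Lemma harmonic_const v (g : V -> R) : (forall y, g y = avg v y g) ->
  forall y x, x \in nb v -> g y = g x.
Proof.
move=> hg.
suff h : forall x x', x \in nb v -> x' \in nb v -> g x = g x'.
  move=> y x xv; rewrite hg -[RHS](avg_cst v y); apply: eq_avg => z zv;
    exact: h.
move=> x0 x1 x0v x1v; have [m mv hm] := seq_max g x0v.
suff h : forall k y x, y \in nb v -> g y = g m -> 0 < chain v k y x ->
  g x = g m.
  have [k0 k0P] := q_irr mv x0v; have [k1 k1P] := q_irr mv x1v.
  by rewrite (h k0 m x0) // (h k1 m x1).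
elim=> [|k IH] y x yv gy /=; first by case: eqP => [<-//|]; rewrite ltxx.
move=> /avg_gt0[w wv]; move: (q_ge0 y wv); rewrite le_eqVlt => /orP[/eqP<-|qw].
  by rewrite mul0r ltxx.
rewrite pmulr_rgt0 //; apply: (IH w x wv); apply/eqP; rewrite eq_le hm //=.
have : 0 = avg v y (fun x => g m + (-1) * g x).
  by rewrite avg_affine -hg gy; ring.
rewrite /avg (big_rem w) //= => h.
have : q v y w * (g m + -1 * g w) <= 0.
  rewrite [leRHS]h lerDl big_seq; apply: sumr_ge0 => a /mem_rem av.
  by apply: mulr_ge0; [exact: q_ge0|rewrite mulN1r subr_ge0 hm].
by rewrite pmulr_rle0 // mulN1r subr_le0.
Qed.

(** After [v] is fired its old rotor is forgotten and the displaced chip does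
    not matter, so the value as a function of the rotor at [v] is its own
    average. *)
Lemma recval_rotor z v y s : nonneg s -> legal s v -> y \in nb v ->
  recval z (State (chips s) (rotor_update (rotors s) v y) (odo s)) = recval z s.
Proof.
move=> s0 sv yv.
pose g x := recval z (start (chips s) (rotor_update (rotors s) v x)).
have Hg rho : (forall x, rotor_update rho v x = rotor_update (rotors s) v x) ->
    recval z (State (chips s) rho (fun=> 0%N)) = avg v (rho v) g.
  move=> rhoE; rewrite (recval_topple z (v := v)) //; apply: eq_avg => x _;
    rewrite recval_odo /=.
  rewrite /g -(recval_relocate z x (s := State (chips s) _ _) s0 sv).
  congr (recval z (State _ _ _)); last by rewrite rhoE.
  by apply/funext => u /=; ring.
have gh x : g x = avg v x g.
  rewrite {1}/g Hg /rotor_update ?eqxx // => x'.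
  by apply/funext => u; case: eqP.
rewrite recval_odo [RHS]recval_odo /= -/(g y) (Hg (rotors s)) //.
rewrite -[LHS](avg_cst v (rotors s v)); apply: eq_avg => x xv.
exact: harmonic_const.
Qed.

Lemma nonneg_fire v y s : nonneg s -> legal s v -> nonneg (fire v y s).
Proof.
move=> s0 sv u /=.
by case: (eqVneq u v) => [->|uv]; move: sv (s0 u); rewrite /legal; lia.
Qed.

Lemma recval_fire z v y s : nonneg s -> legal s v -> y \in nb v ->
  recval z (fire v y s) = recval z s.
Proof.
move=> s0 sv yv; rewrite -(recval_rotor z s0 sv yv).
rewrite -(recval_relocate z y (s := State _ _ _) s0 sv).
rewrite recval_odo [RHS]recval_odo.
by congr (recval z (State _ _ _)); apply/funext => u /=; ring.
Qed.

(** The form [c + (1 - c) Q] of [Q + (1 - Q) c] is affine in the quantity on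
    which the induction runs. When the target is met the value is 1; when time
    is out the value is still at least the recurrence value, which the firings
    did not change. *)
Lemma winlim_ge_interp z K L s : nonneg s ->
  recval z s + (1 - recval z s) * win (atleast z K) L s <=
    winlim (atleast z K) s.
Proof.
have H1 s' : recval z s' <= 1.
  exact: le_trans (recval_le_winlim z s' 0) (winlim_le1 _ _).
elim: L s => [|L IH] s s0.
  have [sK|sK] := boolP (atleast z K (odo s)).
    by rewrite winlim_reached //= sK mulr1 subrKC.
  rewrite /= (negPf sK) mulr0 addr0; exact: recval_le_winlim.
(* The bound is solved for [win], a supremum, which divides by [1 - c]. *)
have [c1|c1] := leP 1 (recval z s).
  have /eqP -> : recval z s == 1 by rewrite eq_le H1.
  by rewrite subrr mul0r addr0 (le_trans c1) // recval_le_winlim.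
rewrite -lerBrDl -ler_pdivlMl ?subr_gt0 //.
apply: winS_le.
  by rewrite ler_pdivlMl ?subr_gt0 // lerBrDl; exact: IH.
move=> v sv; rewrite ler_pdivlMl ?subr_gt0 // lerBrDl.
rewrite -avg_affine; apply: le_trans (topple_winlim_le_legal _ sv).
apply: le_avg => y yv; rewrite -(recval_fire z s0 sv yv); apply: IH.
exact: nonneg_fire.
Qed.

Lemma recval_zero_one z s : nonneg s -> recval z s = 0 \/ recval z s = 1.
Proof.
move=> s0; have H1 : recval z s <= 1.
  exact: le_trans (recval_le_winlim z s 0) (winlim_le1 _ _).
have H0 : 0 <= recval z s by apply: le_recval => K; exact: winlim_ge0.
move: H0; rewrite le_eqVlt => /orP[/eqP<-|H0]; [by left|right].
apply/eqP; rewrite eq_le H1 /=; apply: le_recval => K.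
have c : recval z s + (1 - recval z s) * win (atleast z K) L s @[L --> \oo] -->
         recval z s + (1 - recval z s) * winlim (atleast z K) s.
  by apply: cvgD; [exact: cvg_cst|apply: cvgMr; exact: win_cvg].
have h : recval z s + (1 - recval z s) * winlim (atleast z K) s <=
  winlim (atleast z K) s.
  apply: (ler_cvg_to c (cvg_cst (winlim (atleast z K) s))).
  by apply: nearW => L; exact: winlim_ge_interp.
have : 0 <= recval z s * (winlim (atleast z K) s - 1) by lra.
by rewrite pmulr_rge0 // subr_ge0.
Qed.

(** * Counting visits over balls and moving walkers *)

Lemma ball_total z y : exists L, y \in ball z L.
Proof.
have [s [zs <-]] := nb_conn z y.
suff h : forall a L, a \in ball z L -> path (fun a b => b \in nb a) a s ->
    exists L', last a s \in ball z L' by apply: (h z 0%N) => //; rewrite inE.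
elim: s {zs} => [|x s IH] a L aL /=; first by exists L.
by case/andP=> xa; apply: IH; exact: (ball_nb (nb_sym xa) aL).
Qed.

Lemma ball_mono z L L' : (L <= L')%N -> {subset ball z L <= ball z L'}.
Proof.
move=> /subnK <-; elim: (_ - _)%N => [//|j IH] u uL; rewrite addSn /= mem_cat.
by rewrite IH.
Qed.

Lemma recval_le_allat z B k mu rho : (forall x, 0 <= mu x) ->
  recval z (start mu rho) <=
  winlim (allat B k) (start mu rho).
Proof.
move=> mu0; apply/ler_addgt0Pr => e e0; have [K hK] := spread z B k e0.
apply: le_trans (recval_le_winlim _ _ K) _.
apply: le_trans (hK K (leqnn K) mu rho mu0) _; rewrite lerD2r.
by apply: le_winlim => o /andP[].
Qed.

(** Firing every vertex of a large ball often is asymptotically as likely as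
    firing its centre often: this is recurrence in the limit. *)
Lemma allat_cvg z mu rho : (forall x, 0 <= mu x) ->
  winlim (allat (ball z N) N) (start mu rho) @[N --> \oo] -->
  recval z (start mu rho).
Proof.
move=> mu0; apply: (squeeze_cvgr _ (cvg_cst _) (@recval_cvg z (start mu rho))).
apply: nearW => N; rewrite recval_le_allat //=.
by apply: le_winlim => o /allP; apply; exact: ball_center.
Qed.

Section Positions.
Variables (n : nat) (n_gt0 : (0 < n)%N).

Lemma heap_ge0 (X : {ffun 'I_n -> V}) v : 0 <= heap X v.
Proof. by apply: sumr_ge0. Qed.

(** The walkers are moved one at a time, each move being a relocation. *)
Lemma recval_position z (X X' : {ffun 'I_n -> V}) rho :
  recval z (start (heap X) rho) = recval z (start (heap X') rho).
Proof.
(* The walkers in [r] already stand where [X] puts them. *)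
pose Y (r : seq 'I_n) : {ffun 'I_n -> V} :=
  [ffun j => if j \in r then X j else X' j].
have h r : recval z (start (heap (Y r)) rho) =
           recval z (start (heap X') rho).
  elim: r => [|i r <-].
    by congr (recval z (State (heap _) _ _)); apply/ffunP => j; rewrite ffunE.
  rewrite -(recval_relocate z (v := Y r i) (X i)
    (s := State (heap (Y r)) _ _)) //; last 2 first.
  - by move=> u; exact: heap_ge0.
  - by rewrite /legal /=; exact: heap_gt0.
  have -> : Y (i :: r) = position_update (Y r) i (X i).
    by apply/ffunP => j; rewrite !ffunE inE; case: (eqVneq j i) => [->|].
  by congr (recval z (State _ _ _)); apply/funext => u /=; rewrite heap_update;
    ring.
rewrite -(h (enum 'I_n)); congr (recval z (State (heap _) _ _)).
by apply/ffunP => j; rewrite ffunE mem_enum.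
Qed.

End Positions.
End Game.

(** * Countable and partition arguments *)

Lemma infinite_natP (A : set nat) :
  infinite_set A <-> forall T, exists2 t, (T <= t)%N & A t.
Proof.
split=> [Ainf T|h Afin].
  apply: contrapT => nh; apply: Ainf.
  apply: (sub_finite_set (B := `I_T)); last exact: finite_II.
  by move=> t At /=; rewrite ltnNge; apply/negP => Tt; apply: nh; exists t.
have /finite_seqP[s As] := Afin.
have [t st At] := h (\max_(i <- s) i).+1.
have ts : t \in s by move: At; rewrite As.
by have := leq_bigmax_seq (F := id) t ts isT; move: st; lia.
Qed.

Section Countable.
Variables (d : measure_display) (Omega : measurableType d).

(** The index type is only required to embed in [nat], as no countable
    structure is given on the vertices. *)
Lemma measurable_forall (I : Type) (c : I -> nat) (F : I -> set Omega) :
  injective c -> (forall i, measurable (F i)) ->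
  measurable [set w | forall i, F i w].
Proof.
move=> cI mF.
rewrite (_ : [set w | _] = \bigcap_k [set w | forall i, c i = k -> F i w]);
  last first.
  apply/seteqP; split=> w h; first by move=> k _ i _; exact: h.
  by move=> i; exact: (h (c i)).
apply: bigcapT_measurable => k.
have [[i ik]|nk] := pselect (exists i, c i = k).
  rewrite (_ : [set w | _] = F i) //; apply/seteqP; split=> w; first exact.
  by move=> Fw j; rewrite -ik => /cI ->.
rewrite (_ : [set w | _] = setT); first exact: measurableT.
by apply/seteqP; split=> w // _ i ik; case: nk; exists i.
Qed.

Lemma measurable_countable (I : Type) (c : I -> nat)
    (G : Omega -> I) (Q : set I) :
  injective c -> (forall i, measurable [set w | G w = i]) ->
  measurable [set w | Q (G w)].
Proof.
move=> cI mG.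
rewrite (_ : [set w | _] = \bigcup_k [set w | c (G w) = k /\ Q (G w)]);
  last first.
  apply/seteqP; split=> w; first by move=> QG; exists (c (G w)).
  by case=> k _ [].
apply: bigcup_measurable => k _.
have [[i ik Qi]|nk] := pselect (exists2 i, c i = k & Q i).
  rewrite (_ : [set w | _] = [set w | G w = i]) //; apply/seteqP; split=> w /=.
    by case; rewrite -ik => /cI.
  by move=> ->.
rewrite (_ : [set w | _] = set0); first exact: measurable0.
by apply/seteqP; split=> w // -[ck Qw]; case: nk; exists (G w).
Qed.

Variables (R : realType) (P : probability Omega R).
Variables (V : choiceType) (Y : Omega -> V).
Hypothesis mY : forall y, measurable [set w | Y w = y].

Lemma measurable_mem (r : seq V) : measurable [set w | Y w \in r].
Proof.
elim: r => [|y r IH].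
  by rewrite (_ : [set w | _] = set0); [exact: measurable0|apply/seteqP; split].
rewrite (_ : [set w | _] = [set w | Y w = y] `|` [set w | Y w \in r]).
  exact: measurableU.
apply/seteqP; split=> w /=; rewrite inE; first by case/orP=> [/eqP->|];
  [left|right].
by case=> [->|->]; rewrite ?eqxx ?orbT.
Qed.

Lemma probability_mem (S : set Omega) (r : seq V) : measurable S -> uniq r ->
  P (S `&` [set w | Y w \in r]) = (\sum_(y <- r) P (S `&` [set w | Y w = y]))%E.
Proof.
move=> mS; elim: r => [_|y r IH /= /andP[yr ur]].
  rewrite big_nil (_ : [set w | _] = set0) ?setI0 ?measure0 //.
  by apply/seteqP; split.
rewrite big_cons -IH // -measureU.
- congr (P _); apply/seteqP; split=> w /=.
    by case=> Sw; rewrite inE => /orP[/eqP Yy|Yr]; [left|right].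
  by case=> -[Sw]; [move=> ->; rewrite mem_head|move=> Yr; rewrite inE Yr orbT].
- exact: measurableI.
- by apply: measurableI => //; exact: measurable_mem.
- apply/seteqP; split=> w //= -[[_ Yy] [_ Yr]].
  by rewrite -Yy Yr in yr.
Qed.

(** The events that [Y] takes a value in [r] need not cover the space, but
    what they leave out of [S] is negligible. *)
Lemma probability_partition (S A : set Omega) (r : seq V) :
  measurable S -> measurable A -> uniq r ->
  (\sum_(y <- r) P (S `&` [set w | Y w = y]))%E = P S ->
  P (S `&` A) = (\sum_(y <- r) P (S `&` [set w | Y w = y] `&` A))%E.
Proof.
move=> mS mA ur hS; set B := [set w | Y w \in r].
have mB : measurable B by exact: measurable_mem.
have SB0 : P (S `\` B) = 0.
  have h : P S = (P (S `\` B) + P (S `&` B))%E by exact: measureDI.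
  have SB : P (S `&` B) = P S by rewrite /B probability_mem.
  rewrite SB in h.
  have fS : P S \is a fin_num by exact: fin_num_measure.
  by rewrite -(addeK (P (S `\` B)) fS) -h subee.
have -> : P (S `&` A) = P (S `&` A `&` B).
  rewrite (measureDI P (measurableI _ _ mS mA) mB) -[RHS]add0e; congr (_ + _)%E.
  apply: (subset_measure0 (B := S `\` B)) => //.
  - by apply: measurableD => //; exact: measurableI.
  - exact: measurableD.
  - by move=> w [[]].
rewrite /B probability_mem //; last exact: measurableI.
by apply: eq_bigr => y _; rewrite setIAC.
Qed.

End Countable.

(** * From realizations of the walk to the firing game *)

Section Walk.
Variables (R : realType) (V : choiceType) (E : rel V) (p : V -> V -> V -> R).
Variables (n : nat) (n_gt0 : (0 < n)%N).
Hypothesis graphE : walk_graph E.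
Hypothesis mech : irreducible_local_mechanisms E p.
Variable rho0 : V -> V.
Hypothesis rotor : rotor_configuration E rho0.

Definition nbE (v : V) : seq V := finmap.enum_fset (fset_set (Ngh E v)).

(** The rows of [p] that start outside the neighbourhood carry no information;
    they are overwritten by a genuine row so that averages exist at every
    rotor. *)
Definition qE (v y z : V) : R := p v (if y \in nbE v then y else rho0 v) z.

Lemma mem_nbE v y : (y \in nbE v) = E v y.
Proof.
have [_ _ _ lf] := graphE.
have -> : (y \in nbE v) = (y \in Ngh E v) by exact: in_fset_set.
by apply/idP/idP; rewrite inE.
Qed.

Lemma sum_nbE v (F : V -> R) : \sum_(z \in Ngh E v) F z = \sum_(z <- nbE v) F z.
Proof. by have [_ _ _ lf] := graphE; rewrite fsbig_finite. Qed.

Lemma qE_ge0 v y z : z \in nbE v -> 0 <= qE v y z.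
Proof.
have [[p0 _] _] := mech v; rewrite mem_nbE /qE => vz; apply: p0 => //.
by case: ifP; rewrite ?mem_nbE //; move=> _; exact: rotor.
Qed.

Lemma qE_sum1 v y : \sum_(z <- nbE v) qE v y z = 1.
Proof.
have [[_ p1] _] := mech v; rewrite -sum_nbE; apply: p1.
by case: ifP; rewrite ?mem_nbE //; move=> _; exact: rotor.
Qed.

Lemma nbE_sym x y : y \in nbE x -> x \in nbE y.
Proof. by have [sE _ _ _] := graphE; rewrite !mem_nbE sE. Qed.

Lemma nbE_irr x : x \notin nbE x.
Proof. by have [_ iE _ _] := graphE; rewrite mem_nbE iE. Qed.

Lemma nbE_conn x y : exists s,
  path (fun a b => b \in nbE a) x s /\ last x s = y.
Proof.
have [_ _ cE _] := graphE; have [s [xs <-]] := cE x y; exists s; split=> //.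
by rewrite (eq_path (e' := E)) // => a b; exact: mem_nbE.
Qed.

Lemma chainE u k y z : y \in nbE u ->
  chain nbE qE u k y z = mechanism_iter E p u k y z.
Proof.
elim: k y => [//|k IH] y yu /=; rewrite sum_nbE /avg big_seq [RHS]big_seq.
by apply: eq_bigr => x xu; rewrite /qE yu IH.
Qed.

Lemma qE_irr u y z : y \in nbE u -> z \in nbE u ->
  exists k, 0 < chain nbE qE u k y z.
Proof.
have [_ irr] := mech u => yu zu.
have [k hk] : exists k, 0 < mechanism_iter E p u k y z.
  by apply: irr; rewrite /Ngh /= -mem_nbE.
by exists k; rewrite chainE.
Qed.

(** The vertices fired before time [t]. The odometer is read off this list
    because a list of vertices takes countably many values. *)
Definition sites (h : nat -> {ffun 'I_n -> V}) (t : nat) : seq V :=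
  [seq h s (walker n_gt0 s) | s <- iota 0 t].

Definition fired h t (v : V) : nat := count_mem v (sites h t).

Lemma sitesS h t : sites h t.+1 = rcons (sites h t) (h t (walker n_gt0 t)).
Proof. by rewrite /sites -addn1 iotaD map_cat /= add0n cats1. Qed.

Lemma firedS h t v : fired h t.+1 v =
  (fired h t v + (v == h t (walker n_gt0 t)))%N.
Proof. by rewrite /fired sitesS -cats1 count_cat /= addn0 eq_sym. Qed.

Lemma fired_mono h t t' v : (t <= t')%N -> (fired h t v <= fired h t' v)%N.
Proof.
move=> /subnK <-; elim: (_ - _)%N => [//|j IH].
by rewrite addSn firedS (leq_trans IH) // leq_addr.
Qed.

Variables (d : measure_display) (Omega : measurableType d).
Variables (P : probability Omega R) (X : nat -> Omega -> {ffun 'I_n -> V}).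
Variables (rhot : nat -> Omega -> V -> V) (x0 : {ffun 'I_n -> V}).
Hypothesis walk : is_RWLM E p n_gt0 P X rhot x0 rho0.

Let traj w t := X t w.

(** A vertex is coded by the radius of a ball that contains it and its index in
    this ball. *)
Lemma countable_code : exists c : V -> nat, injective c.
Proof.
pose z := x0 (walker n_gt0 0).
have /choice[L hL] : forall y, exists L, y \in ball nbE z L.
  exact: ball_total nbE_sym nbE_conn z.
exists (fun y => pickle (L y, index y (ball nbE z (L y)))) =>
  y y' /(pcan_inj pickleK) [Ly].
rewrite -Ly => iy; rewrite -(nth_index z (hL y)) iy nth_index //.
by rewrite Ly.
Qed.

Lemma measurable_sites t (Q : set (seq V)) :
  measurable [set w | Q (sites (traj w) t)].
Proof.
have [c cI] := countable_code.
apply: (measurable_countable (c := fun s => pickle (map c s))).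
  by move=> s s' /(pcan_inj pickleK); exact: inj_map.
move=> l; elim: t l => [|t IH] l.
  have [->|l0] := pselect (l = [::]).
    by rewrite (_ : [set w | _] = setT);
      [exact: measurableT|apply/seteqP; split].
  rewrite (_ : [set w | _] = set0); first exact: measurable0.
  by apply/seteqP; split=> w // h; case: l0; rewrite -h.
case/lastP: l => [|l v].
  rewrite (_ : [set w | _] = set0); first exact: measurable0.
  by apply/seteqP; split=> w //=; rewrite sitesS; case: (sites _ _).
rewrite (_ : [set w | _] = [set w | sites (traj w) t = l] `&`
    [set w | X t w (walker n_gt0 t) = v]).
  apply: measurableI; [exact: IH|exact: RWLM_measurable_position walk _ _ _].
apply/seteqP; split=> w /=; rewrite sitesS.
  by move=> /rcons_inj[-> ->].
by case=> -> <-.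
Qed.

Lemma measurable_history h eta t : measurable (same_history X rhot h eta t).
Proof.
apply: (measurable_forall (c := id)) => // s.
have [c cI] := countable_code.
have [st|st] := leqP s t; last first.
  by rewrite (_ : (fun w => _) = setT);
    [exact: measurableT|apply/seteqP; split].
rewrite (_ : (fun w => _) = [set w | forall i, X s w i = h s i] `&`
    [set w | forall v, rhot s w v = eta s v]).
  apply: measurableI.
    apply: (measurable_forall (c := @nat_of_ord n)
      (F := fun i => [set w | X s w i = h s i])).
      exact: ord_inj.
    by move=> i; exact: RWLM_measurable_position walk _ _ _.
  apply: (measurable_forall
    (F := fun v => [set w | rhot s w v = eta s v]) cI) => v.
  exact: RWLM_measurable_rotor walk _ _ _.
apply/seteqP; split=> w /=.
  by move=> /(_ isT)[-> ->].
by case=> hX hr _; split; [apply/ffunP|apply/funext].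
Qed.

Definition extend (T : Type) (h : nat -> T) (s : nat) (a : T) (k : nat) : T :=
  if (k <= s)%N then h k else a.

Lemma sites_extend h s a : sites (extend h s a) s.+1 = sites h s.+1.
Proof.
by apply/eq_in_map => k; rewrite mem_iota add0n ltnS /extend => /andP[_ ->].
Qed.

Lemma extend_old (T : Type) (h : nat -> T) s a k : (k <= s)%N ->
  extend h s a k = h k.
Proof. by rewrite /extend => ->. Qed.

Lemma extend_new (T : Type) (h : nat -> T) s a : extend h s a s.+1 = a.
Proof. by rewrite /extend ltnn. Qed.

Lemma history_extend h eta s y : let i := walker n_gt0 s in
  same_history X rhot h eta s `&` [set w | X s.+1 w i = y] =
  same_history X rhot (extend h s (position_update (h s) i y))
    (extend eta s (rotor_update (eta s) (h s i) y)) s.+1.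
Proof.
move=> i; apply/seteqP; split=> w.
  case=> hs Xy k; rewrite leq_eqVlt => /orP[/eqP ->|]; last first.
    by rewrite ltnS => ks; rewrite !extend_old //; exact: hs.
  rewrite !extend_new; have [<- <-] := hs s (leqnn s).
  have [hr hX] := RWLM_step walk s w.
  by split; [rewrite hX -/i Xy|rewrite hr -/i Xy].
move=> hs; split.
  by move=> k ks; have := hs k (leqW ks); rewrite !extend_old.
have [/= -> _] := hs s.+1 (leqnn _).
by rewrite extend_new ffunE eqxx.
Qed.

(** Induction on the number of steps left, conditioning on the history.  The
    neighbours exhaust the next position up to a null event because the sampling
    probabilities sum to 1. *)
Lemma probability_fired (f : (V -> nat) -> bool) t s h eta :
  (forall u, Ngh E u (eta s u)) ->
  P (same_history X rhot h eta s `&` [set w | f (fired (traj w) (t + s)%N)]) =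
  (P (same_history X rhot h eta s) *
   (robin nbE qE n_gt0 f t s (h s) (eta s) (fired h s))%:E)%E.
Proof.
elim: t s h eta => [|t IH] s h eta etaN.
  rewrite add0n /=.
  have ff w : same_history X rhot h eta s w -> fired (traj w) s = fired h s.
    move=> hw; rewrite /fired (_ : sites (traj w) s = sites h s) //.
    apply/eq_in_map => k; rewrite mem_iota add0n /traj => /andP[_ ks].
    by have [-> _] := hw k (ltnW ks).
  case: (boolP (f (fired h s))) => fs; rewrite ?mule1 ?mule0.
    congr (P _); apply/seteqP; split=> w; first by case.
    by move=> hw; split=> //=; rewrite ff.
  rewrite -(measure0 P); congr (P _); apply/seteqP; split=> w //.
  by case=> hw /=; rewrite ff // (negPf fs).
set S := same_history X rhot h eta s; set A := [set w | _].
pose i := walker n_gt0 s; pose a := h s i.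
have mS : measurable S by exact: measurable_history.
have mA : measurable A.
  exact: (measurable_sites _ (fun l => f (fun v => count_mem v l))).
have mY y : measurable [set w | X s.+1 w i = y].
  exact: RWLM_measurable_position walk _ _ _.
have sample y : y \in nbE a ->
    P (S `&` [set w | X s.+1 w i = y]) = (P S * (qE a (eta s a) y)%:E)%E.
  rewrite mem_nbE => ya; rewrite /qE mem_nbE etaN.
  exact: (RWLM_sample walk).
have PSf : P S = (fine (P S))%:E by rewrite fineK // fin_num_measure.
have total : (\sum_(y <- nbE a) P (S `&` [set w | X s.+1 w i = y]))%E = P S.
  rewrite big_seq (eq_bigr _ sample) -big_seq PSf.
  under eq_bigr do rewrite -EFinM.
  by rewrite sumEFin -mulr_sumr qE_sum1 mulr1.
rewrite (probability_partition mY mS mA _ total) ?finmap.fset_uniq //.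
rewrite [in RHS]PSf -EFinM /= /avg -/i -/a mulr_sumr -sumEFin.
rewrite big_seq [RHS]big_seq; apply: eq_bigr => y ya.
rewrite history_extend /A addSnnS IH.
  rewrite -history_extend sample // PSf -!EFinM !extend_new mulrA.
  congr ((_ * robin _ _ _ _ _ _ _ _ _)%:E); apply/funext => v.
  by rewrite /fired sites_extend -/(fired h s.+1 v) firedS.
move=> u; rewrite extend_new /rotor_update; case: eqP => // ->.
by rewrite /Ngh /= -mem_nbE.
Qed.

Lemma probability_fired0 (f : (V -> nat) -> bool) t :
  P [set w | f (fired (traj w) t)] =
  (robin nbE qE n_gt0 f t 0 x0 rho0 (fun=> 0%N))%:E.
Proof.
have := @probability_fired f t 0 (fun=> x0) (fun=> rho0) rotor.
have -> : same_history X rhot (fun=> x0) (fun=> rho0) 0 = setT.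
  apply/seteqP; split=> w // _ k; rewrite leqn0 => /eqP ->.
  exact: RWLM_init walk w.
by rewrite setTI addn0 probability_setT mul1e.
Qed.

(** A walker waits at its vertex until its turn. *)
Lemma visit_fire w t i v : X t w i = v ->
  exists2 t', (t <= t')%N & X t' w (walker n_gt0 t') = v.
Proof.
have [j] := walker_turn n_gt0 t i; elim: j t => [|j IH] t ti Xv.
  by exists t => //; rewrite -[t]addn0 ti addn0.
have [<-|it] := eqVneq (X t w (walker n_gt0 t)) v; first by exists t.
have Xv' : X t.+1 w i = v.
  have [_ ->] := RWLM_step walk t w; rewrite ffunE; case: eqP => // ii.
  by rewrite -ii Xv eqxx in it.
have [|t' tt' Xt'] := IH t.+1 _ Xv'; first by rewrite addSnnS.
by exists t' => //; exact: ltnW.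
Qed.

Lemma fired_le_visits w T v :
  (forall t, (T <= t)%N -> X t w (walker n_gt0 t) <> v) ->
  forall t, (fired (traj w) t v <= T)%N.
Proof.
move=> h t; suff : (fired (traj w) t v <= minn t T)%N.
  by rewrite leq_min => /andP[].
elim: t => [|t IH]; first by rewrite min0n.
rewrite firedS; move: IH; rewrite /traj; set k := fired _ _ _ => IH.
case: eqP => [vX|_]; last by move: IH; rewrite !leq_min; lia.
have : ~~ (T <= t)%N by apply/negP => /h; rewrite -vX.
by move: IH; rewrite !leq_min; lia.
Qed.

(** A vertex is visited infinitely often exactly when its odometer is
    unbounded. *)
Lemma recurrentE z : recurrent X =
  \bigcap_N \bigcup_t [set w | allat (ball nbE z N) N (fired (traj w) t)].
Proof.
apply/seteqP; split=> w.
  move=> rec N _.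
  have unb v k : exists t, (k <= fired (traj w) t v)%N.
    elim: k => [|k [t kt]]; first by exists 0%N.
    have [t1 tt1 [i Xv]] := (infinite_natP _).1 (rec v) t.
    have [t2 t12 Xt2] := visit_fire Xv.
    exists t2.+1; rewrite firedS /traj Xt2 eqxx addn1 ltnS.
    by rewrite (leq_trans kt) // fired_mono // (leq_trans tt1).
  elim: (ball _ _ _) => [|v B [t _ /= hB]]; first by exists 0%N.
  have [t' ht'] := unb v N; exists (maxn t t') => //=; apply/andP; split.
    by rewrite (leq_trans ht') // fired_mono // leq_maxr.
  apply/allP => u uB; move/allP/(_ u uB): hB => /leq_trans; apply.
  by rewrite fired_mono // leq_maxl.
move=> h v; apply/infinite_natP => T; apply: contrapT => nv.
have [L vL] := ball_total nbE_sym nbE_conn z v.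
have [t _ /= /allP/(_ v)] := h (maxn L T.+1) I.
move=> /(_ (ball_mono (leq_maxl L T.+1) vL)).
have : (fired (traj w) t v <= T)%N; last by lia.
apply: fired_le_visits => t' Tt' Xt'; apply: nv; exists t' => //.
by exists (walker n_gt0 t').
Qed.

(** Two monotone limits: first in time for a fixed target, then in the target.
    *)
Lemma probability_recurrent z : P (recurrent X) =
  (recval nbE qE z (State (heap x0) rho0 (fun=> 0%N)))%:E.
Proof.
pose f N := allat (ball nbE z N) N; pose s0 := State (heap x0) rho0 (fun=> 0%N).
pose A N t := [set w | f N (fired (traj w) t)].
have mA N t : measurable (A N t).
  exact: (measurable_sites _ (fun l => f N (fun v => count_mem v l))).
have mf N : mono (f N) by exact: mono_allat.
have PA N : P (\bigcup_t A N t) = (winlim nbE qE (f N) s0)%:E.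
  have c1 : P \o A N @ \oo --> P (\bigcup_t A N t).
    apply: nondecreasing_cvg_mu => //; first exact: bigcup_measurable.
    apply/nondecreasing_seqP => t; apply/subsetPset => w; apply: mf => v.
    exact: fired_mono.
  have c2 : P \o A N @ \oo --> (winlim nbE qE (f N) s0)%:E.
    rewrite (_ : P \o A N = EFin \o (fun t => robin nbE qE n_gt0 (f N)
      t 0 x0 rho0 (fun=> 0%N))).
      apply: cvg_EFin; first by apply: nearW.
      rewrite -(robinlim_winlim qE_ge0 qE_sum1 n_gt0 0 x0 rho0 (fun=> 0%N)
        (mf N)).
      exact: (robin_cvg qE_ge0 qE_sum1).
    by apply/funext => t; exact: probability_fired0.
  exact: cvg_unique c1 c2.
rewrite (recurrentE z).
have c1 :
    P \o (fun N => \bigcup_t A N t) @ \oo --> P (\bigcap_N \bigcup_t A N t).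
  have mU N : measurable (\bigcup_t A N t) by exact: bigcup_measurable.
  apply: nonincreasing_cvg_mu => //.
  - by rewrite ltey_eq fin_num_measure.
  - exact: bigcapT_measurable.
  - apply/nonincreasing_seqP => N; apply/subsetPset => w [t _ /allP h];
    exists t => //.
    apply/allP => u uB; apply: leq_trans (leqnSn N) (h u _).
    exact: (ball_mono (leqnSn N)).
have c2 : P \o (fun N => \bigcup_t A N t) @ \oo --> (recval nbE qE z s0)%:E.
  rewrite (_ : P \o _ = EFin \o (fun N => winlim nbE qE (f N) s0)).
    apply: cvg_EFin; first by apply: nearW.
    apply: (allat_cvg qE_ge0 qE_sum1 nbE_irr nbE_conn qE_irr) => v.
    exact: heap_ge0.
  by apply/funext => N; exact: PA.
exact: cvg_unique c1 c2.
Qed.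

End Walk.

Theorem proposition2p9 (R : realType) (V : choiceType) (E : rel V)
    (p : V -> V -> V -> R) (n : nat) (n_gt0 : (0 < n)%N) (rho : V -> V)
    (graphE : walk_graph E) (mech : irreducible_local_mechanisms E p)
    (rotor : rotor_configuration E rho) :
  exists prec : R,
    is_recurrence_probability E p n_gt0 rho prec /\ (prec = 0 \/ prec = 1).
Proof.
have q_ge0 := qE_ge0 graphE mech rotor.
have q_sum1 := qE_sum1 graphE mech rotor.
have q_irr := qE_irr graphE mech rho.
have [[x1 _]|no_position] := pselect (exists x : {ffun 'I_n -> V}, True);
  last first.
  by exists 0; split; [move=> x; case: no_position; exists x|left].
pose z := x1 (walker n_gt0 0).
exists (recval (nbE E) (qE E p rho) z (State (heap x1) rho (fun=> 0%N)));
  split; last first.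
  apply: (recval_zero_one q_ge0 q_sum1 (nbE_sym graphE) (nbE_irr graphE)
    (nbE_conn graphE) q_irr).
  by move=> u; exact: heap_ge0.
move=> x d Omega P X rhot walk.
rewrite (probability_recurrent graphE mech rotor walk z); congr (_%:E).
exact: (recval_position q_ge0 q_sum1 (nbE_sym graphE) (nbE_irr graphE)
  (nbE_conn graphE) q_irr).
Qed.
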